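(* Let $(V,m,b)$ be an infinite weighted directed graph satisfying the standing assumptions (locally finite, weakly connected, $\sum_{y}b(x,y)>0$ for all $x$, and Kirchhoff's assumption), and let $\Delta=H+B$ be the decomposition of its Laplacian into symmetric part $H=\frac12(\Delta+\Delta')$ and skew-symmetric part $B=\frac12(\Delta-\Delta')$ on $\mathcal C_c(V)$. If $H$ is essentially self-adjoint and $B$ is bounded, then $\overline{\Delta}$ is m-accretive.
   Context: Graph: $V$ is a countable set, $b:V\times V\to[0,\infty)$ satisfies $b(x,x)=0$ for all $x$, and $m:V\to(0,\infty)$ is a weight on vertices. For $x\in V$, $V_x=\{y\in V: b(x,y)>0\text{ or }b(y,x)>0\}$. Standing assumptions: (1) locally finite: every $V_x$ is finite; (2) weakly connected: any two vertices are joined by a finite chain of undirected edges $\{x,y\}$ (pairs with $b(x,y)>0$ or $b(y,x)>0$); (3) $\sum_{y\in V}b(x,y)>0$ for all $x\in V$; (4) Kirchhoff's assumption: $\sum_{y}b(x,y)=\sum_{y}b(y,x)$ for all $x\in V$. Function spaces: $\mathcal C_c(V)$ is the set of finitely supported functions $V\to\mathbb C$; $\ell^2(V,m)$ is the Hilbert space of $f:V\to\mathbb C$ with $\sum_x m(x)|f(x)|^2<\infty$, with scalar product $\langle f,g\rangle=\sum_x m(x)f(x)\overline{g(x)}$. Operators on $\ell^2(V,m)$ with domain $\mathcal C_c(V)$: $\Delta f(x)=\frac{1}{m(x)}\sum_{y}b(x,y)(f(x)-f(y))$ and its formal adjoint $\Delta' f(x)=\frac{1}{m(x)}\sum_{y}b(y,x)(f(x)-f(y))$;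 $H$ and $B$ have domain $\mathcal C_c(V)$. $\Delta$ is closable, with closure $\overline{\Delta}$. ''$B$ is bounded'' means there is $K$ with $\|Bf\|\le K\|f\|$ for all $f\in\mathcal C_c(V)$. ''$H$ is essentially self-adjoint'' means its closure in $\ell^2(V,m)$ is self-adjoint. An operator $A$ with domain $D(A)$ is accretive if $\operatorname{Re}\langle Af,f\rangle\ge 0$ for all $f\in D(A)$. An accretive operator $A$ is m-accretive if the open left half-plane is contained in its resolvent set and $\|(A+\lambda)^{-1}\|\le \frac{1}{\operatorname{Re}\lambda}$ for all $\lambda$ with $\operatorname{Re}\lambda>0$. *)

(* Defs.v *)
From HB Require Import structures.
From mathcomp Require Import all_boot all_order all_algebra.
From mathcomp Require Import complex.
From mathcomp Require Import boolp classical_sets functions cardinality fsbigop.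
From mathcomp Require Import reals constructive_ereal ereal numfun esum.

Set Implicit Arguments.
Unset Strict Implicit.
Unset Printing Implicit Defensive.

Import Order.TTheory GRing.Theory Num.Theory.

Local Open Scope classical_set_scope.
Local Open Scope ring_scope.
Local Open Scope complex_scope.

Record weighted_digraph (R : realType) (V : countType) := WeightedDigraph {
  edge_weight : V -> V -> R ;
  vertex_weight : V -> R ;
  edge_weight_ge0 : forall x y, 0 <= edge_weight x y ;
  edge_weight_diag : forall x, edge_weight x x = 0 ;
  vertex_weight_gt0 : forall x, 0 < vertex_weight x }.

Section Graph.
Variables (R : realType) (V : countType) (G : weighted_digraph R V).
Local Notation b := (edge_weight G).
Local Notation m := (vertex_weight G).
Implicit Type f : V -> R[i].

Definition adjacent : rel V := fun x y => (0 < b x y) || (0 < b y x).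

Definition neighbours (x : V) : set V := [set y | adjacent x y].

Definition locally_finite : Prop := forall x, finite_set (neighbours x).

Definition weakly_connected : Prop :=
  forall x y, exists2 s : seq V, path adjacent x s & last x s = y.

(* The sums over all of V below have finite support when the graph is locally
   finite; [\sum_(y \in [set: V])] sums over that support. *)
Definition positive_outdegree : Prop :=
  forall x, 0 < \sum_(y \in [set: V]) b x y.

Definition kirchhoff : Prop :=
  forall x, \sum_(y \in [set: V]) b x y = \sum_(y \in [set: V]) b y x.

Definition laplacian f : V -> R[i] := fun x =>
  ((m x)^-1)%:C * \sum_(y \in [set: V]) (b x y)%:C * (f x - f y).

Definition laplacian_adj f : V -> R[i] := fun x =>
  ((m x)^-1)%:C * \sum_(y \in [set: V]) (b y x)%:C * (f x - f y).

Definition laplacian_sym f : V -> R[i] := fun x =>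
  2^-1 * (laplacian f x + laplacian_adj f x).

Definition laplacian_skew f : V -> R[i] := fun x =>
  2^-1 * (laplacian f x - laplacian_adj f x).

End Graph.

Section WeightedL2.
Variables (R : realType) (V : countType) (m : V -> R).
Implicit Types f g h : V -> R[i].

(* Unconditional sums over V; meaningful for absolutely summable families. *)
Definition real_sum (u : V -> R) : R :=
  fine (\esum_(x in [set: V]) (EFin \o u)^\+%E x
        - \esum_(x in [set: V]) (EFin \o u)^\-%E x)%E.

Definition complex_sum (u : V -> R[i]) : R[i] :=
  real_sum (fun x => complex.Re (u x)) +i* real_sum (fun x => complex.Im (u x)).

Definition l2_sqnorm f : \bar R :=
  \esum_(x in [set: V]) (m x * ComplexField.Normc.normc (f x) ^+ 2)%:E.

Definition l2 : set (V -> R[i]) := [set f | (l2_sqnorm f < +oo)%E].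

Definition l2_norm f : R := Num.sqrt (fine (l2_sqnorm f)).

Definition l2_inner f g : R[i] :=
  complex_sum (fun x => (m x)%:C * f x * (g x)^*).

Definition finitely_supported : set (V -> R[i]) :=
  [set f | finite_set [set x | f x != 0]].

(* Unbounded operators on l2 are represented by their graphs, so that D(A) is
   the set of first components of the pairs in A. *)
Definition op_graph := set ((V -> R[i]) * (V -> R[i])).
Implicit Type A : op_graph.

Definition graph_on (D : set (V -> R[i])) (T : (V -> R[i]) -> (V -> R[i])) :
    op_graph :=
  [set p | D p.1 /\ p.2 = T p.1].

Definition single_valued A : Prop :=
  forall f g h, A (f, g) -> A (f, h) -> g = h.

Definition is_operator A : Prop :=
  [/\ forall p, A p -> l2 p.1 /\ l2 p.2,
      A (fun=> 0, fun=> 0),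
      forall (a : R[i]) p q, A p -> A q ->
        A (fun x => a * p.1 x + q.1 x, fun x => a * p.2 x + q.2 x)
    & single_valued A].

Definition bounded_op A : Prop :=
  exists K : R, forall p, A p -> l2_norm p.2 <= K * l2_norm p.1.

Definition op_norm A : \bar R :=
  ereal_sup [set (l2_norm p.2)%:E | p in [set p | A p /\ l2_norm p.1 <= 1]].

Definition op_closure A : op_graph :=
  [set p | [/\ l2 p.1, l2 p.2 & forall e : R, 0 < e -> exists2 q, A q &
    l2_norm (p.1 \- q.1) < e /\ l2_norm (p.2 \- q.2) < e]].

Definition densely_defined A : Prop :=
  forall f, l2 f -> forall e : R, 0 < e ->
    exists2 q, A q & l2_norm (f \- q.1) < e.

Definition op_adjoint A : op_graph :=
  [set p | [/\ l2 p.1, l2 p.2 &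
    forall q, A q -> l2_inner q.2 p.1 = l2_inner q.1 p.2]].

Definition self_adjoint A : Prop :=
  [/\ is_operator A, densely_defined A & op_adjoint A = A].

Definition essentially_self_adjoint A : Prop := self_adjoint (op_closure A).

Definition op_shift A (z : R[i]) : op_graph :=
  [set (p.1, fun x => p.2 x + z * p.1 x) | p in A].

Definition op_inverse A : op_graph := [set (p.2, p.1) | p in A].

(* z is in the resolvent set when (A - z)^-1 is a bounded operator defined on
   all of l2. *)
Definition resolvent_set A : set R[i] :=
  [set z | let T := op_inverse (op_shift A (- z)) in
    [/\ is_operator T, forall h, l2 h -> exists f, T (h, f) & bounded_op T]].

Definition accretive A : Prop :=
  is_operator A /\ forall p, A p -> 0 <= complex.Re (l2_inner p.2 p.1).

Definition m_accretive A : Prop :=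
  [/\ accretive A,
      forall z : R[i], complex.Re z < 0 -> resolvent_set A z
    & forall l : R[i], 0 < complex.Re l ->
        (op_norm (op_inverse (op_shift A l)) <= ((complex.Re l)^-1)%:E)%E].

End WeightedL2.

(* Main.v *)
Require Import Defs.
From mathcomp Require Import all_boot all_order all_algebra.
From mathcomp Require Import complex finmap ring lra.
From mathcomp Require Import boolp classical_sets functions cardinality fsbigop.
From mathcomp Require Import reals constructive_ereal ereal numfun esum.
From mathcomp Require Import topology normedtype.

(** Kirchhoff's assumption makes the Laplacian accretive on finitely supported
functions: summing [Re ((f x - f y) * conj (f x))] against [b x y], the part
[|f x|^2 - |f y|^2] of the polarization identity cancels because out- and
in-weights agree ([laplacian_accretive_sum]). Accretivity gives, for
[a = Re l > 0], the estimate [a * |f| <= |Delta f + l f|]; it passes to the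
closure and yields injectivity, the resolvent bound and the norm bound of the
m-accretivity definition. What remains is that [closure Delta + l] is onto.

Surjectivity is obtained without orthogonal projections, in two steps.

First, the pointwise equation [Delta f + l f = h] has a square-summable solution
for every square-summable [h] ([resolvent_equation]). On a finite set [s] the
equation, for functions vanishing off [s], is a square linear system, which the
estimate makes nonsingular ([dirichlet_problem]). The solutions along an
exhaustion of [V] are bounded by [|h| / a], so by Tychonoff they have a pointwise
cluster point; local finiteness lets the equation pass to it, and finite
partial sums bound its norm.

Second, such an [f] lies in the domain of the closure
([closure_laplacian_maximal]). This is where the hypotheses on [H] and [B] enter.
The bound on [B], being tested on truncations, extends to all square-summable
functions, so [B f], hence [H f = h - l f - B f], is square summable. Green's
formula then puts [(f, H f)] in the adjoint of the closure of [H], which is the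
closure of [H] by essential self-adjointness. Finitely supported [q] that
approximate [f] in the graph norm of [H] do so in that of [Delta = H + B],
since [B] is bounded. *)

Import Order.TTheory GRing.Theory Num.Theory.
Import numFieldNormedType.Exports.

Local Open Scope classical_set_scope.

Set Implicit Arguments.
Unset Strict Implicit.
Unset Printing Implicit Defensive.

Local Notation normc := ComplexField.Normc.normc.
Local Notation Re := complex.Re.
Local Notation Im := complex.Im.
Local Notation conj := Num.conj.

(** * Finite sums and complex moduli *)

Section FiniteSums.
Local Open Scope ring_scope.

Lemma eq_sum_support (M : nmodType) (V : eqType) (s t : seq V) (F : V -> M) :
  uniq s -> uniq t -> {in s, forall x, x \notin t -> F x = 0} ->
  {in t, forall x, x \notin s -> F x = 0} ->
  \sum_(x <- s) F x = \sum_(x <- t) F x.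
Proof.
move=> us ut st ts.
rewrite (bigID (mem t)) /= [X in _ + X]big1_seq ?addr0; last first.
  by move=> x /andP[/[swap]]; exact: st.
rewrite [RHS](bigID (mem s)) /= [X in _ = _ + X]big1_seq ?addr0; last first.
  by move=> x /andP[/[swap]]; exact: ts.
rewrite -big_filter -[RHS]big_filter; apply: perm_big.
by apply: uniq_perm; rewrite ?filter_uniq// => x; rewrite !mem_filter /= andbC.
Qed.

Lemma fsbig_support_seq (M : nmodType) (V : choiceType) (s : seq V) (F : V -> M) :
  uniq s -> (forall x, x \notin s -> F x = 0) ->
  \sum_(x \in [set: V]) F x = \sum_(x <- s) F x.
Proof.
move=> us s0; rewrite (fsbig_seq _ F us); apply/esym/fsbig_widen => // x [_ xs].
by apply: s0; apply/negP.
Qed.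

Lemma ler_sum_subseq (R : numDomainType) (V : eqType) (s t : seq V) (F : V -> R) :
  uniq s -> uniq t -> {subset s <= t} -> (forall x, 0 <= F x) ->
  \sum_(x <- s) F x <= \sum_(x <- t) F x.
Proof.
move=> us ut st F0; rewrite [leRHS](bigID (mem s)) /= -[in leRHS]big_filter.
have -> : \sum_(x <- [seq x <- t | x \in s]) F x = \sum_(x <- s) F x.
  apply: perm_big; apply: uniq_perm; rewrite ?filter_uniq// => x.
  by rewrite mem_filter andb_idr// => xs; exact: st.
by rewrite lerDl; apply: sumr_ge0.
Qed.

End FiniteSums.

Section Modulus.
Local Open Scope ring_scope.
Local Open Scope complex_scope.
Variable R : realType.
Implicit Types z w : R[i].

Lemma sqr_normcE z : normc z ^+ 2 = Re z ^+ 2 + Im z ^+ 2.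
Proof. by case: z => a b; rewrite /normc sqr_sqrtr// addr_ge0 ?sqr_ge0. Qed.

Lemma normc_ge0 z : 0 <= normc z.
Proof. by case: z => a b; rewrite /normc sqrtr_ge0. Qed.

Lemma ler_normcD z w : normc (z + w) <= normc z + normc w.
Proof. exact: (@le_normcD R z w). Qed.

Lemma normc_opp z : normc (- z) = normc z.
Proof. by case: z => a b; rewrite /normc /= !sqrrN. Qed.

Lemma normc_real (r : R) : normc r%:C = `|r|.
Proof. by rewrite /normc /= expr0n addr0 sqrtr_sqr. Qed.

Lemma normc_eq0P z : (normc z == 0) = (z == 0).
Proof.
apply/eqP/eqP=> [/ComplexField.Normc.eq0_normc//|->]; exact: ComplexField.Normc.normc0.
Qed.

Lemma normc_ReIm z : normc z <= `|Re z| + `|Im z|.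
Proof.
rewrite -(@ler_pXn2r _ 2) ?nnegrE ?addr_ge0 ?normr_ge0 ?normc_ge0//.
rewrite sqr_normcE sqrrD !real_normK ?num_real// -addrA lerD2l.
by rewrite lerDr mulrn_wge0// mulr_ge0.
Qed.

Lemma ler_ReIm z : `|Re z| <= normc z /\ `|Im z| <= normc z.
Proof.
by split; rewrite -(@ler_pXn2r _ 2) ?nnegrE ?normc_ge0// sqr_normcE real_normK ?num_real//
  ?lerDl ?lerDr ?sqr_ge0.
Qed.

Lemma ler_normc_sum (I : Type) (s : seq I) (F : I -> R[i]) :
  normc (\sum_(i <- s) F i) <= \sum_(i <- s) normc (F i).
Proof.
elim/big_ind2 : _ => [|a b c d ab cd|//]; first by rewrite ComplexField.Normc.normc0.
by apply: le_trans (ler_normcD _ _) _; exact: lerD.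
Qed.

Lemma conjM z w : conj (z * w) = conj z * conj w. Proof. exact: rmorphM. Qed.
Lemma conjB z w : conj (z - w) = conj z - conj w. Proof. exact: rmorphB. Qed.
Lemma conjR (r : R) : conj r%:C = r%:C. Proof. exact: conjc_real. Qed.

Lemma ReD z w : Re (z + w) = Re z + Re w. Proof. by case: z w => [? ?] []. Qed.
Lemma ImD z w : Im (z + w) = Im z + Im w. Proof. by case: z w => [? ?] []. Qed.

Lemma Re_sum (I : Type) (s : seq I) (F : I -> R[i]) :
  Re (\sum_(i <- s) F i) = \sum_(i <- s) Re (F i).
Proof. by elim/big_rec2 : _ => // i y1 y2 _ <-; rewrite ReD. Qed.

Lemma Im_sum (I : Type) (s : seq I) (F : I -> R[i]) :
  Im (\sum_(i <- s) F i) = \sum_(i <- s) Im (F i).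
Proof. by elim/big_rec2 : _ => // i y1 y2 _ <-; rewrite ImD. Qed.

Lemma conj_sum (I : Type) (s : seq I) (F : I -> R[i]) :
  conj (\sum_(i <- s) F i) = \sum_(i <- s) conj (F i).
Proof. exact: rmorph_sum. Qed.

End Modulus.

(** * Square-summable functions *)

Section L2.
Local Open Scope ring_scope.
Local Open Scope complex_scope.
Variables (R : realType) (V : countType) (m : V -> R).
Hypothesis m_gt0 : forall x, 0 < m x.
Implicit Types (f g h : V -> R[i]) (s : seq V).

Definition sqsum s f : R := \sum_(x <- s) m x * normc (f x) ^+ 2.

Lemma sqsum_term_ge0 f x : 0 <= m x * normc (f x) ^+ 2.
Proof. by rewrite mulr_ge0 ?sqr_ge0// ltW. Qed.

Lemma sqsum_ge0 s f : 0 <= sqsum s f.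
Proof. by apply: sumr_ge0 => x _; exact: sqsum_term_ge0. Qed.

Lemma l2_normr_ge0 f : 0 <= l2_norm m f.
Proof. exact: sqrtr_ge0. Qed.

Lemma esum_le_seq (a : V -> R) (C : R) :
  (forall s, uniq s -> \sum_(x <- s) a x <= C) ->
  (\esum_(x in [set: V]) (a x)%:E <= C%:E)%E.
Proof.
move=> aC; apply: ge_ereal_sup => _ [A [finA _] <-].
by rewrite fsbig_finite// sumEFin lee_fin; apply: aC; exact: fset_uniq.
Qed.

Lemma le_esum_seq (a : V -> R) s : uniq s ->
  ((\sum_(x <- s) a x)%:E <= \esum_(x in [set: V]) (a x)%:E)%E.
Proof.
move=> us; apply: ereal_sup_ubound; exists [set` s]; first by split=> //; exact: finite_seq.
by rewrite -fsbig_seq// sumEFin.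
Qed.

(** Near-optimal finite sums, as sequences: this is what turns statements on
[\esum] into statements on finite sums. *)
Lemma esum_seq_approx (a : V -> R) (e : R) : 0 < e -> (forall x, 0 <= a x) ->
  (\esum_(x in [set: V]) (a x)%:E < +oo)%E ->
  exists2 s, uniq s & fine (\esum_(x in [set: V]) (a x)%:E) - e < \sum_(x <- s) a x.
Proof.
move=> e0 a0 afin.
have fin : \esum_(x in [set: V]) (a x)%:E \is a fin_num.
  by rewrite ge0_fin_numE// esum_ge0// => x _; rewrite lee_fin.
have [_ [A [finA _] <-] lt] := ub_ereal_sup_adherent e0 fin.
exists (fset_set A); first exact: fset_uniq.
move: lt; rewrite fsbig_finite// sumEFin -[X in (X + _ < _)%E](fineK fin).
by rewrite -EFinN -EFinD lte_fin.
Qed.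

(** A supremum bound on finite sums gives membership and a norm bound at once;
most estimates below are made on finite sums and concluded through it. *)
Lemma l2_bounded f (C : R) : 0 <= C ->
  (forall s, uniq s -> sqsum s f <= C ^+ 2) -> l2 m f /\ l2_norm m f <= C.
Proof.
move=> C0 fC; have le := esum_le_seq fC.
split; first by apply: le_lt_trans le _; exact: ltry.
rewrite /l2_norm -[leRHS]ger0_norm// -sqrtr_sqr ler_wsqrtr//.
rewrite -lee_fin fineK// ge0_fin_numE; first by apply: le_lt_trans le _; exact: ltry.
by apply: esum_ge0 => x _; rewrite lee_fin sqsum_term_ge0.
Qed.

Lemma sqsum_le_norm f s : l2 m f -> uniq s -> sqsum s f <= l2_norm m f ^+ 2.
Proof.
move=> lf us; have ge0 : (0 <= l2_sqnorm m f)%E.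
  by rewrite esum_ge0// => x _; rewrite lee_fin sqsum_term_ge0.
rewrite /l2_norm sqr_sqrtr ?fine_ge0// -lee_fin fineK ?ge0_fin_numE//.
exact: (@le_esum_seq (fun x => m x * normc (f x) ^+ 2)).
Qed.

(** Since [a] and [b] are only upper bounds for the norms, they can be taken
positive, and the pointwise inequality
[(p + q)^2 <= (1 + b/a) p^2 + (1 + a/b) q^2] sums up to the square of [a + b]
with no separate treatment of null functions. *)
Lemma sqsum_Minkowski s f g (a b : R) : 0 < a -> 0 < b ->
  sqsum s f <= a ^+ 2 -> sqsum s g <= b ^+ 2 ->
  sqsum s (fun x => f x + g x) <= (a + b) ^+ 2.
Proof.
move=> a0 b0 fa gb.
have -> : (a + b) ^+ 2 = (1 + b / a) * a ^+ 2 + (1 + a / b) * b ^+ 2.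
  by field; rewrite ?gt_eqF.
apply: (@le_trans _ _ ((1 + b / a) * sqsum s f + (1 + a / b) * sqsum s g)); last first.
  by apply: lerD; apply: ler_wpM2l => //; rewrite addr_ge0// divr_ge0// ltW.
rewrite /sqsum !mulr_sumr -big_split /=; apply: ler_sum => x _.
rewrite !(mulrCA _ (m x)) -mulrDr ler_wpM2l ?(ltW (m_gt0 x))//.
set p := normc (f x); set q := normc (g x).
apply: (@le_trans _ _ ((p + q) ^+ 2)).
  by rewrite ler_pXn2r ?nnegrE ?addr_ge0 ?normc_ge0// ler_normcD.
rewrite -subr_ge0.
have -> : (1 + b / a) * p ^+ 2 + (1 + a / b) * q ^+ 2 - (p + q) ^+ 2 =
    (b * p - a * q) ^+ 2 / (a * b) by field; rewrite ?gt_eqF.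
by rewrite divr_ge0 ?sqr_ge0// mulr_ge0// ltW.
Qed.

Lemma l2_normD f g : l2 m f -> l2 m g ->
  l2 m (fun x => f x + g x) /\
  l2_norm m (fun x => f x + g x) <= l2_norm m f + l2_norm m g.
Proof.
move=> lf lg.
have key (e : R) : 0 < e -> l2 m (fun x => f x + g x) /\
    l2_norm m (fun x => f x + g x) <= (l2_norm m f + e) + (l2_norm m g + e).
  move=> e0; have pos h : 0 < l2_norm m h + e.
    by rewrite ltr_wpDl// l2_normr_ge0.
  apply: l2_bounded => [|s us]; first by rewrite addr_ge0// ltW.
  apply: sqsum_Minkowski => //.
    apply: le_trans (sqsum_le_norm lf us) _.
    by rewrite ler_pXn2r ?nnegrE ?l2_normr_ge0 ?ltW// ltrDl.
  apply: le_trans (sqsum_le_norm lg us) _.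
  by rewrite ler_pXn2r ?nnegrE ?l2_normr_ge0 ?ltW// ltrDl.
split; first by have [] := key 1 ltr01.
apply/ler_addgt0Pr => e e0; have [_ le] := key (e / 2) (divr_gt0 e0 (ltr0Sn _ 1)).
lra.
Qed.

Lemma l2_normZ (a : R[i]) f : l2 m f ->
  l2 m (fun x => a * f x) /\ l2_norm m (fun x => a * f x) <= normc a * l2_norm m f.
Proof.
move=> lf; apply: l2_bounded; first by rewrite mulr_ge0 ?normc_ge0 ?l2_normr_ge0.
move=> s us; rewrite exprMn.
apply: (@le_trans _ _ (normc a ^+ 2 * sqsum s f)); last first.
  by rewrite ler_wpM2l ?sqr_ge0// sqsum_le_norm.
rewrite /sqsum mulr_sumr; apply: ler_sum => x _.
by rewrite ComplexField.Normc.normcM exprMn mulrCA.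
Qed.

Lemma l2_normB f g : l2 m f -> l2 m g ->
  l2 m (f \- g) /\ l2_norm m (f \- g) <= l2_norm m f + l2_norm m g.
Proof.
move=> lf lg; have [l le] := l2_normZ (-1) lg.
have [l' le'] := l2_normD lf l.
have -> : f \- g = fun x => f x + -1 * g x by apply/funext => x; rewrite mulN1r.
split=> //; apply: le_trans le' _; rewrite lerD2l; apply: le_trans le _.
by rewrite normc_opp ComplexField.Normc.normc1 mul1r.
Qed.

Lemma le_normc_l2 f x : l2 m f -> normc (f x) <= l2_norm m f / Num.sqrt (m x).
Proof.
move=> lf; have sx : 0 < Num.sqrt (m x) by rewrite sqrtr_gt0.
rewrite ler_pdivlMr// -(@ler_pXn2r _ 2) ?nnegrE ?mulr_ge0 ?normc_ge0
  ?l2_normr_ge0 ?sqrtr_ge0//.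
rewrite exprMn sqr_sqrtr ?(ltW (m_gt0 x))// mulrC.
by have := @sqsum_le_norm f [:: x] lf isT; rewrite /sqsum big_seq1.
Qed.

Lemma l2_0 : l2 m (fun=> 0) /\ l2_norm m (fun=> 0) = 0.
Proof.
have [l le] : l2 m (fun=> 0) /\ l2_norm m (fun=> 0) <= 0.
  apply: l2_bounded => // s _; rewrite /sqsum big1 ?expr0n// => x _.
  by rewrite ComplexField.Normc.normc0 expr0n mulr0.
by split=> //; apply/eqP; rewrite eq_le le l2_normr_ge0.
Qed.

Lemma l2_norm_finite f s : uniq s -> (forall x, x \notin s -> f x = 0) ->
  l2 m f /\ l2_norm m f ^+ 2 = sqsum s f.
Proof.
move=> us s0.
have sq := sqr_sqrtr (sqsum_ge0 s f).
have [l le] : l2 m f /\ l2_norm m f <= Num.sqrt (sqsum s f).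
  apply: l2_bounded; first exact: sqrtr_ge0.
  move=> t ut; rewrite sq.
  apply: (@le_trans _ _ (sqsum (undup (s ++ t)) f)).
    apply: ler_sum_subseq; rewrite ?undup_uniq//; last exact: sqsum_term_ge0.
    by move=> x xt; rewrite mem_undup mem_cat xt orbT.
  rewrite le_eqVlt; apply/orP; left; apply/eqP; apply: eq_sum_support; rewrite ?undup_uniq//.
    by move=> x _ /s0 ->; rewrite ComplexField.Normc.normc0 expr0n mulr0.
  by move=> x xs; rewrite mem_undup mem_cat xs.
split=> //; apply/eqP; rewrite eq_le sqsum_le_norm// andbT -sq.
by rewrite ler_pXn2r ?nnegrE ?l2_normr_ge0 ?sqrtr_ge0.
Qed.

Definition inner_sum s f g : R[i] := \sum_(x <- s) (m x)%:C * f x * conj (g x).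

(** Unconditional convergence: the positive and the negative part are both
within [e] of their sums as soon as [s] contains a near-optimal set for each. *)
Lemma real_sum_approx (u : V -> R) (C e : R) : 0 < e ->
  (forall s, uniq s -> \sum_(x <- s) `|u x| <= C) ->
  exists2 s0, uniq s0 & forall s, uniq s -> {subset s0 <= s} ->
    `|real_sum u - \sum_(x <- s) u x| <= e.
Proof.
move=> e0 uC.
pose p x := Num.max (u x) 0; pose n x := Num.max (- u x) 0.
have p0 x : 0 <= p x by rewrite le_max lexx orbT.
have n0 x : 0 <= n x by rewrite le_max lexx orbT.
have upn x : u x = p x - n x.
  rewrite /p /n; case: (lerP (u x) 0) => ux.
    by rewrite max_l ?oppr_ge0// sub0r opprK.
  by rewrite max_r ?subr0// oppr_le0 ltW.
have pu x : p x <= `|u x| by rewrite /p ge_max ler_norm normr_ge0.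
have nu x : n x <= `|u x| by rewrite /n ge_max -normrN ler_norm normr_ge0.
have finp : (\esum_(x in [set: V]) (p x)%:E < +oo)%E.
  apply: (@le_lt_trans _ _ C%:E); last exact: ltry.
  by apply: esum_le_seq => s us; apply: le_trans (uC s us); exact: ler_sum.
have finn : (\esum_(x in [set: V]) (n x)%:E < +oo)%E.
  apply: (@le_lt_trans _ _ C%:E); last exact: ltry.
  by apply: esum_le_seq => s us; apply: le_trans (uC s us); exact: ler_sum.
have fp : \esum_(x in [set: V]) (p x)%:E \is a fin_num.
  by rewrite ge0_fin_numE// esum_ge0// => x _; rewrite lee_fin.
have fn : \esum_(x in [set: V]) (n x)%:E \is a fin_num.
  by rewrite ge0_fin_numE// esum_ge0// => x _; rewrite lee_fin.
have Eu : real_sum u =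
    fine (\esum_(x in [set: V]) (p x)%:E) - fine (\esum_(x in [set: V]) (n x)%:E).
  rewrite /real_sum -fineB//; congr (fine (_ - _)%E); apply: eq_esum => x _.
    by rewrite funeposE /p EFin_max.
  by rewrite funenegE /n EFin_max.
have [sp usp lp] := esum_seq_approx e0 p0 finp.
have [sn usn ln] := esum_seq_approx e0 n0 finn.
exists (undup (sp ++ sn)); first exact: undup_uniq.
move=> s us sub.
have -> : \sum_(x <- s) u x = \sum_(x <- s) p x - \sum_(x <- s) n x.
  by rewrite -sumrB; apply: eq_bigr => x _; exact: upn.
have up := le_esum_seq p us; have un := le_esum_seq n us.
rewrite -(fineK fp) lee_fin in up; rewrite -(fineK fn) lee_fin in un.
have lp' : \sum_(x <- sp) p x <= \sum_(x <- s) p x.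
  by apply: ler_sum_subseq => // x xs; apply: sub; rewrite mem_undup mem_cat xs.
have ln' : \sum_(x <- sn) n x <= \sum_(x <- s) n x.
  by apply: ler_sum_subseq => // x xs; apply: sub; rewrite mem_undup mem_cat xs orbT.
rewrite Eu ler_norml; apply/andP; split; lra.
Qed.
End L2.

(** * The inner product as a limit of finite sums *)

Section Inner.
Local Open Scope ring_scope.
Local Open Scope complex_scope.
Variables (R : realType) (V : countType) (m : V -> R).
Hypothesis m_gt0 : forall x, 0 < m x.
Implicit Types (f g h : V -> R[i]) (s : seq V).

(** The arithmetic-geometric inequality [2 p q <= (b/a) p^2 + (a/b) q^2], weighted
so that its sum is [a * b]. *)
Lemma sum_normc_CauchySchwarz s f g (a b : R) : 0 < a -> 0 < b ->
  sqsum m s f <= a ^+ 2 -> sqsum m s g <= b ^+ 2 ->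
  \sum_(x <- s) m x * (normc (f x) * normc (g x)) <= a * b.
Proof.
move=> a0 b0 fa gb.
have -> : a * b = 2^-1 * (b / a * a ^+ 2 + a / b * b ^+ 2).
  by field; rewrite ?gt_eqF.
apply: (@le_trans _ _ (2^-1 * (b / a * sqsum m s f + a / b * sqsum m s g))); last first.
  rewrite ler_wpM2l ?invr_ge0//.
  by apply: lerD; apply: ler_wpM2l => //; rewrite divr_ge0// ltW.
rewrite /sqsum !mulr_sumr -big_split /= mulr_sumr; apply: ler_sum => x _.
rewrite !(mulrCA _ (m x)) -mulrDr [leRHS]mulrCA ler_wpM2l ?(ltW (m_gt0 x))//.
set p := normc (f x); set q := normc (g x); rewrite -subr_ge0.
have -> : 2^-1 * (b / a * p ^+ 2 + a / b * q ^+ 2) - p * q =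
    2^-1 * ((b * p - a * q) ^+ 2 / (a * b)) by field; rewrite ?gt_eqF.
by rewrite mulr_ge0 ?invr_ge0// divr_ge0 ?sqr_ge0// mulr_ge0// ltW.
Qed.

Lemma normc_inner_term f g x :
  normc ((m x)%:C * f x * conj (g x)) = m x * (normc (f x) * normc (g x)).
Proof.
rewrite !ComplexField.Normc.normcM normc_real ger0_norm ?(ltW (m_gt0 x))// mulrA.
by congr (_ * _); case: (g x) => c d; rewrite /normc /= sqrrN.
Qed.

Lemma normc_inner_sum_le s f g (a b : R) : 0 < a -> 0 < b ->
  sqsum m s f <= a ^+ 2 -> sqsum m s g <= b ^+ 2 ->
  normc (inner_sum m s f g) <= a * b.
Proof.
move=> a0 b0 fa gb; apply: le_trans (ler_normc_sum _ _) _.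
under eq_bigr do rewrite normc_inner_term.
exact: sum_normc_CauchySchwarz.
Qed.

Lemma sqsum_le_sqr f s (a : R) : l2 m f -> uniq s -> l2_norm m f <= a ->
  sqsum m s f <= a ^+ 2.
Proof.
move=> lf us fa; apply: le_trans (sqsum_le_norm m_gt0 lf us) _.
by rewrite ler_pXn2r ?nnegrE ?l2_normr_ge0// (le_trans (l2_normr_ge0 _ _) fa).
Qed.

Lemma l2_inner_approx f g (e : R) : l2 m f -> l2 m g -> 0 < e ->
  exists2 s0, uniq s0 & forall s, uniq s -> {subset s0 <= s} ->
    normc (l2_inner m f g - inner_sum m s f g) <= e.
Proof.
move=> lf lg e0; have e20 : 0 < e / 2 by rewrite divr_gt0.
pose u x := (m x)%:C * f x * conj (g x).
pose C := (l2_norm m f + 1) * (l2_norm m g + 1).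
have pos h : 0 < l2_norm m h + 1 by rewrite ltr_wpDl// l2_normr_ge0.
have uC s : uniq s -> \sum_(x <- s) normc (u x) <= C.
  move=> us; under eq_bigr do rewrite normc_inner_term.
  by apply: sum_normc_CauchySchwarz => //; apply: sqsum_le_sqr => //; rewrite lerDl.
have [s1 us1 h1] : exists2 s0, uniq s0 & forall s, uniq s -> {subset s0 <= s} ->
    `|real_sum (fun x => Re (u x)) - \sum_(x <- s) Re (u x)| <= e / 2.
  apply: (@real_sum_approx _ _ _ C) => // s us; apply: le_trans (uC s us).
  by apply: ler_sum => x _; have [] := ler_ReIm (u x).
have [s2 us2 h2] : exists2 s0, uniq s0 & forall s, uniq s -> {subset s0 <= s} ->
    `|real_sum (fun x => Im (u x)) - \sum_(x <- s) Im (u x)| <= e / 2.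
  apply: (@real_sum_approx _ _ _ C) => // s us; apply: le_trans (uC s us).
  by apply: ler_sum => x _; have [] := ler_ReIm (u x).
exists (undup (s1 ++ s2)); first exact: undup_uniq.
move=> s us sub; apply: le_trans (normc_ReIm _) _.
rewrite [leRHS](splitr e); apply: lerD.
  apply: le_trans (h1 s us _); last by move=> x xs; apply: sub; rewrite mem_undup mem_cat xs.
  by rewrite -Re_sum /inner_sum; case: (\sum_(_ <- _) _).
apply: le_trans (h2 s us _); last by move=> x xs; apply: sub; rewrite mem_undup mem_cat xs orbT.
by rewrite -Im_sum /inner_sum; case: (\sum_(_ <- _) _).
Qed.

Lemma inner_sumB s f g f' g' : inner_sum m s f g - inner_sum m s f' g' =
  inner_sum m s (f \- f') g + inner_sum m s f' (g \- g').
Proof.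
rewrite /inner_sum -sumrB -big_split /=; apply: eq_bigr => x _.
by rewrite /= conjB; ring.
Qed.

(** Joint continuity of the inner product. It is read off finite sums, where
bilinearity is plain. *)
Lemma l2_inner_close f g f' g' (a b c d : R) :
  l2 m f -> l2 m g -> l2 m f' -> l2 m g' -> 0 < a -> 0 < b -> 0 < c -> 0 < d ->
  l2_norm m (f \- f') <= a -> l2_norm m g <= b ->
  l2_norm m f' <= c -> l2_norm m (g \- g') <= d ->
  normc (l2_inner m f g - l2_inner m f' g') <= a * b + c * d.
Proof.
move=> lf lg lf' lg' a0 b0 c0 d0 fa gb fc gd; apply/ler_addgt0Pr => e e0.
have e20 : 0 < e / 2 by rewrite divr_gt0.
have [s1 us1 h1] := l2_inner_approx lf lg e20.
have [s2 us2 h2] := l2_inner_approx lf' lg' e20.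
pose s := undup (s1 ++ s2); have us : uniq s by exact: undup_uniq.
have {}h1 := h1 s us _; have {}h2 := h2 s us _.
have {}h1 : normc (l2_inner m f g - inner_sum m s f g) <= e / 2.
  by apply: h1 => x xs; rewrite mem_undup mem_cat xs.
have {}h2 : normc (l2_inner m f' g' - inner_sum m s f' g') <= e / 2.
  by apply: h2 => x xs; rewrite mem_undup mem_cat xs orbT.
have -> : l2_inner m f g - l2_inner m f' g' =
    (inner_sum m s (f \- f') g + inner_sum m s f' (g \- g')) +
    ((l2_inner m f g - inner_sum m s f g) - (l2_inner m f' g' - inner_sum m s f' g')).
  by rewrite -inner_sumB; ring.
apply: le_trans (ler_normcD _ _) _; apply: lerD.
  apply: le_trans (ler_normcD _ _) _; apply: lerD; apply: normc_inner_sum_le => //;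
    by apply: sqsum_le_sqr => //; exact: (l2_normB m_gt0 _ _).1.
apply: le_trans (ler_normcD _ _) _; rewrite normc_opp [leRHS](splitr e).
exact: lerD.
Qed.

Lemma real_sum_finite (u : V -> R) s : uniq s -> (forall x, x \notin s -> u x = 0) ->
  real_sum u = \sum_(x <- s) u x.
Proof.
move=> us u0; apply/eqP; rewrite -subr_eq0 -normr_le0; apply/ler_addgt0Pr => e e0.
have [|s0 us0 h] := @real_sum_approx _ _ u (\sum_(x <- s) `|u x|) e e0.
  move=> t ut; apply: (@le_trans _ _ (\sum_(x <- undup (s ++ t)) `|u x|)).
    apply: ler_sum_subseq; rewrite ?undup_uniq// => x xt.
    by rewrite mem_undup mem_cat xt orbT.
  rewrite le_eqVlt; apply/orP; left; apply/eqP; apply: eq_sum_support; rewrite ?undup_uniq//.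
    by move=> x _ /u0 ->; rewrite normr0.
  by move=> x xs; rewrite mem_undup mem_cat xs.
rewrite add0r; have -> : \sum_(x <- s) u x = \sum_(x <- undup (s0 ++ s)) u x.
  apply: eq_sum_support; rewrite ?undup_uniq//.
    by move=> x xs; rewrite mem_undup mem_cat xs orbT.
  by move=> x _ /u0.
apply: h; first exact: undup_uniq.
by move=> x xs; rewrite mem_undup mem_cat xs.
Qed.

Lemma l2_inner_finite f g s : uniq s ->
  (forall x, x \notin s -> f x = 0 \/ g x = 0) ->
  l2_inner m f g = inner_sum m s f g.
Proof.
move=> us s0; have z x : x \notin s -> (m x)%:C * f x * conj (g x) = 0.
  by move=> /s0[] ->; rewrite ?rmorph0 ?mulr0 ?mul0r.
rewrite /l2_inner /complex_sum !(real_sum_finite us) => [|x /z ->//|x /z ->//].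
by rewrite -Re_sum -Im_sum /inner_sum; case: (\sum_(_ <- _) _).
Qed.

End Inner.

(** * Closures of local operators on finitely supported functions *)

Section ClosureOfLocalOperator.
Local Open Scope ring_scope.
Local Open Scope complex_scope.
Variables (R : realType) (V : countType) (m : V -> R).
Hypothesis m_gt0 : forall x, 0 < m x.
Variable L : (V -> R[i]) -> V -> R[i].
Hypothesis L_linear : forall (a : R[i]) f g,
  L (fun x => a * f x + g x) = fun x => a * L f x + L g x.
Hypothesis L_local : forall x, exists (M : R) (s : seq V), 0 <= M /\
  forall f, normc (L f x) <= M * \sum_(y <- s) normc (f y).
Hypothesis L_finite : forall f, finitely_supported f -> finitely_supported (L f).

Lemma finitely_supportedP (f : V -> R[i]) : finitely_supported f <->
  exists2 s : seq V, uniq s & forall x, x \notin s -> f x = 0.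
Proof.
split=> [ff|[s us s0]].
  exists (fset_set [set x | f x != 0]); first exact: fset_uniq.
  by move=> x; rewrite in_fset_set// notin_setE /= => /negP; rewrite negbK => /eqP.
apply: (@sub_finite_set _ _ [set` s]) (finite_seq s) => x /=.
by apply: contraR => /s0 ->.
Qed.

Lemma finitely_supported_l2 f : finitely_supported f -> l2 m f.
Proof.
by move=> /finitely_supportedP[s us s0]; have [] := l2_norm_finite m_gt0 us s0.
Qed.

(** The form in which all limits in [e] are taken: equalities and inequalities on
closures hold up to [e * K] with [K] fixed. *)
Lemma le0_vanishing_bound (t K : R) : 0 <= K -> (forall e, 0 < e -> t <= e * K) -> t <= 0.
Proof.
move=> K0 tK; apply/ler_addgt0Pr => e e0; rewrite add0r.
have K1 : 0 < K + 1 by rewrite ltr_wpDl.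
apply: le_trans (tK (e / (K + 1)) (divr_gt0 e0 K1)) _.
by rewrite mulrAC ler_pdivrMr// ler_wpM2l ?(ltW e0)// lerDl.
Qed.

(** Norm convergence implies pointwise convergence, and [L q x] depends
continuously on finitely many values of [q]; hence the closure of [L] still acts
by the pointwise formula. In particular [L] is closable. *)
Lemma op_closure_pointwise p :
  op_closure m (graph_on (@finitely_supported R V) L) p -> p.2 = L p.1.
Proof.
move=> [l1 l2' app]; apply/funext => x; apply/eqP; rewrite -subr_eq0 -normc_eq0P.
rewrite eq_le normc_ge0 andbT.
have [M [s [M0 Ms]]] := L_local x.
apply: (@le0_vanishing_bound _ ((Num.sqrt (m x))^-1 + M * \sum_(y <- s) (Num.sqrt (m y))^-1)).
  by rewrite addr_ge0 ?invr_ge0 ?sqrtr_ge0// mulr_ge0// sumr_ge0.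
move=> e e0; have [q [fq q2] [n1 n2]] := app e e0.
have lq1 := finitely_supported_l2 fq.
have lq2 : l2 m q.2 by rewrite q2; exact/finitely_supported_l2/L_finite.
have -> : p.2 x - L p.1 x = (p.2 \- q.2) x + L (fun y => -1 * p.1 y + q.1 y) x.
  by rewrite L_linear /= q2; ring.
apply: le_trans (ler_normcD _ _) _; rewrite mulrDr; apply: lerD.
  apply: le_trans (le_normc_l2 m_gt0 x (l2_normB m_gt0 l2' lq2).1) _.
  by rewrite ler_wpM2r ?invr_ge0 ?sqrtr_ge0// ltW.
apply: le_trans (Ms _) _; rewrite mulrCA ler_wpM2l// mulr_sumr; apply: ler_sum => y _.
have -> : -1 * p.1 y + q.1 y = - ((p.1 \- q.1) y) by rewrite /=; ring.
rewrite normc_opp.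
apply: le_trans (le_normc_l2 m_gt0 y (l2_normB m_gt0 l1 lq1).1) _.
by rewrite ler_wpM2r ?invr_ge0 ?sqrtr_ge0// ltW.
Qed.

Lemma local_operator0 : L (fun=> 0) = fun=> 0.
Proof.
apply/funext => x; have [M [s [_ Ms]]] := L_local x; apply/eqP.
rewrite -normc_eq0P eq_le normc_ge0 andbT; apply: le_trans (Ms _) _.
by rewrite big1 ?mulr0// => y _; rewrite ComplexField.Normc.normc0.
Qed.

Lemma op_closure_is_operator :
  is_operator m (op_closure m (graph_on (@finitely_supported R V) L)).
Proof.
have [z nz] := l2_0 m_gt0.
split; first by move=> p [].
- split=> //= e e0; exists (fun=> 0, fun=> 0).
    split; last by rewrite /= local_operator0.
    by apply/finitely_supportedP; exists [::].
  have -> : (fun=> 0) \- (fun=> 0) = (fun=> 0) :> (V -> R[i]).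
    by apply/funext => x; rewrite /= subr0.
  by rewrite /= nz.
- move=> a p q [lp1 lp2 ap] [lq1 lq2 aq].
  split=> /=.
  + by apply: (l2_normD m_gt0 _ lq1).1; exact: (l2_normZ m_gt0 a lp1).1.
  + by apply: (l2_normD m_gt0 _ lq2).1; exact: (l2_normZ m_gt0 a lp2).1.
  + move=> e e0; pose d := e / (normc a + 2).
    have a2 : 0 < normc a + 2 by rewrite ltr_wpDl// normc_ge0.
    have d0 : 0 < d by rewrite divr_gt0.
    have [p' [fp' Ep'] [np1 np2]] := ap d d0.
    have [q' [fq' Eq'] [nq1 nq2]] := aq d d0.
    have lin f g f' g' : l2 m f -> l2 m g -> l2 m f' -> l2 m g' ->
        l2_norm m (f \- f') < d -> l2_norm m (g \- g') < d ->
        l2_norm m ((fun x => a * f x + g x) \- (fun x => a * f' x + g' x)) < e.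
      move=> lf lg lf' lg' nf ng.
      have -> : (fun x => a * f x + g x) \- (fun x => a * f' x + g' x) =
          (fun x => a * (f \- f') x + (g \- g') x).
        by apply/funext => x /=; ring.
      have [lff' _] := l2_normB m_gt0 lf lf'; have [lgg' _] := l2_normB m_gt0 lg lg'.
      have [laf naf] := l2_normZ m_gt0 a lff'.
      apply: le_lt_trans (l2_normD m_gt0 laf lgg').2 _.
      have -> : e = (normc a + 1) * d + d.
        by rewrite /d; field; rewrite gt_eqF.
      apply: ler_ltD => //; apply: le_trans naf _.
      apply: ler_pM; rewrite ?normc_ge0 ?l2_normr_ge0//.
        by rewrite lerDl.
      exact: ltW.
    have fpq : finitely_supported (fun x => a * p'.1 x + q'.1 x).
      move: fp' fq' => /finitely_supportedP[s us s0] /finitely_supportedP[t ut t0].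
      apply/finitely_supportedP; exists (undup (s ++ t)); first exact: undup_uniq.
      move=> x; rewrite mem_undup mem_cat negb_or => /andP[/s0 -> /t0 ->].
      by rewrite mulr0 addr0.
    exists (fun x => a * p'.1 x + q'.1 x, fun x => a * p'.2 x + q'.2 x).
      by split=> //=; rewrite L_linear Ep' Eq'.
    split; apply: lin => //; rewrite ?Ep' ?Eq';
      by apply: finitely_supported_l2 => //; exact: L_finite.
- by move=> f g h /op_closure_pointwise /= -> /op_closure_pointwise /= ->.
Qed.

(** A lower bound for [L + l] on finitely supported functions survives graph
limits, both sides being continuous in the graph norm. *)
Lemma op_closure_bound (a : R) (l : R[i]) : 0 <= a ->
  (forall f, finitely_supported f ->
     a * l2_norm m f <= l2_norm m (fun x => L f x + l * f x)) ->
  forall p, op_closure m (graph_on (@finitely_supported R V) L) p ->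
     a * l2_norm m p.1 <= l2_norm m (fun x => p.2 x + l * p.1 x).
Proof.
move=> a0 La p [l1 l2' app]; rewrite -subr_le0.
apply: (@le0_vanishing_bound _ (a + (1 + normc l))).
  by rewrite addr_ge0// addr_ge0// normc_ge0.
move=> e e0; have [q [fq q2] [n1 n2]] := app e e0.
have lq1 := finitely_supported_l2 fq.
have lq2 : l2 m q.2 by rewrite q2; exact/finitely_supported_l2/L_finite.
have lb1 := (l2_normB m_gt0 l1 lq1).1; have lb2 := (l2_normB m_gt0 l2' lq2).1.
have up : l2_norm m p.1 <= l2_norm m q.1 + e.
  have -> : p.1 = fun x => q.1 x + (p.1 \- q.1) x.
    by apply/funext => x /=; ring.
  by apply: le_trans (l2_normD m_gt0 lq1 lb1).2 _; rewrite lerD2l ltW.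
have uq : l2_norm m (fun x => q.2 x + l * q.1 x) <=
    l2_norm m (fun x => p.2 x + l * p.1 x) + (e + normc l * e).
  have -> : (fun x => q.2 x + l * q.1 x) =
      fun x => (p.2 x + l * p.1 x) + (-1 * ((p.2 \- q.2) x + l * (p.1 \- q.1) x)).
    by apply/funext => x /=; ring.
  have [lz1 nz1] := l2_normZ m_gt0 l l1.
  have [lz nz] := l2_normZ m_gt0 l lb1.
  have [ls ns] := l2_normD m_gt0 lb2 lz.
  have [lN nN] := l2_normZ m_gt0 (-1) ls.
  have [lp _] := l2_normD m_gt0 l2' lz1.
  apply: le_trans (l2_normD m_gt0 lp lN).2 _; rewrite lerD2l.
  apply: le_trans nN _; rewrite normc_opp ComplexField.Normc.normc1 mul1r.
  apply: le_trans ns _; apply: lerD; first exact: ltW.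
  by apply: le_trans nz _; rewrite ler_wpM2l ?normc_ge0// ltW.
have := La _ fq; rewrite -q2 => aq.
have : a * l2_norm m p.1 <= a * (l2_norm m q.1 + e) by rewrite ler_wpM2l.
by nra.
Qed.

End ClosureOfLocalOperator.

(** * Laplacians with arbitrary edge weights *)

Section GraphOperators.
Local Open Scope ring_scope.
Local Open Scope complex_scope.
Variables (R : realType) (V : countType) (G : weighted_digraph R V).
Hypothesis G_lf : locally_finite G.
Local Notation b := (edge_weight G).
Local Notation m := (vertex_weight G).
Local Notation m_gt0 := (vertex_weight_gt0 G).
Implicit Types (f g h : V -> R[i]) (s : seq V) (c : V -> V -> R).

Definition nbseq (x : V) : seq V := fset_set (neighbours G x).

Lemma nbseq_uniq x : uniq (nbseq x). Proof. exact: fset_uniq. Qed.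

Lemma mem_nbseq x y : (y \in nbseq x) = adjacent G x y.
Proof.
rewrite /nbseq in_fset_set//; apply/idP/idP => [|yx]; first by rewrite inE.
by rewrite inE.
Qed.

Lemma adjacentC x y : adjacent G x y = adjacent G y x.
Proof. by rewrite /adjacent orbC. Qed.

Lemma edge_weight0 x y : ~~ adjacent G x y -> b x y = 0.
Proof.
rewrite negb_or -leNgt => /andP[b0 _]; apply/eqP.
by rewrite eq_le b0 edge_weight_ge0.
Qed.

Definition adjacency_supported c := forall x y, ~~ adjacent G x y -> c x y = 0.

(** The Laplacian, its formal adjoint and their symmetric and skew parts are all of
this form, for [c] the edge weight, its transpose, and the half sum and half
difference of the two; [c] may therefore take negative values. *)
Definition weighted_laplacian c f : V -> R[i] := fun x =>
  ((m x)^-1)%:C * \sum_(y <- nbseq x) (c x y)%:C * (f x - f y).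

Lemma laplacian_sumE c f x : adjacency_supported c ->
  \sum_(y \in [set: V]) (c x y)%:C * (f x - f y) =
  \sum_(y <- nbseq x) (c x y)%:C * (f x - f y).
Proof.
move=> c0; apply: fsbig_support_seq; first exact: nbseq_uniq.
by move=> y; rewrite mem_nbseq => /c0 ->; rewrite mul0r.
Qed.

Lemma adjacency_supportedT c :
  adjacency_supported c -> adjacency_supported (fun x y => c y x).
Proof. by move=> c0 x y; rewrite adjacentC => /c0. Qed.

Lemma adjacency_supported_edge : adjacency_supported b.
Proof. exact: edge_weight0. Qed.

Lemma laplacianE f : laplacian G f = weighted_laplacian b f.
Proof.
apply/funext => x; rewrite /laplacian /weighted_laplacian laplacian_sumE//.
exact: adjacency_supported_edge.
Qed.

Lemma laplacian_adjE f : laplacian_adj G f = weighted_laplacian (fun x y => b y x) f.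
Proof.
apply/funext => x; rewrite /laplacian_adj /weighted_laplacian.
by rewrite (laplacian_sumE _ _ (adjacency_supportedT adjacency_supported_edge)).
Qed.

Definition sym_weight x y : R := 2^-1 * (b x y + b y x).
Definition skew_weight x y : R := 2^-1 * (b x y - b y x).

Lemma laplacian_symE f : laplacian_sym G f = weighted_laplacian sym_weight f.
Proof.
apply/funext => x; rewrite /laplacian_sym laplacianE laplacian_adjE /weighted_laplacian.
rewrite -mulrDr mulrCA -big_split /= [in LHS]mulr_sumr; congr (_ * _).
apply: eq_bigr => y _; rewrite -mulrDl mulrA; congr (_ * _).
by rewrite /sym_weight rmorphM rmorphD fmorphV rmorph_nat.
Qed.

Lemma laplacian_skewE f : laplacian_skew G f = weighted_laplacian skew_weight f.
Proof.
apply/funext => x; rewrite /laplacian_skew laplacianE laplacian_adjE /weighted_laplacian.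
rewrite -mulrBr mulrCA -sumrB [in LHS]mulr_sumr; congr (_ * _).
apply: eq_bigr => y _; rewrite -mulrBl mulrA; congr (_ * _).
by rewrite /skew_weight rmorphM rmorphB fmorphV rmorph_nat.
Qed.

Lemma laplacian_sym_skew f : laplacian G f =
  fun x => laplacian_sym G f x + laplacian_skew G f x.
Proof.
apply/funext => x; rewrite /laplacian_sym /laplacian_skew.
by field.
Qed.

Lemma weighted_laplacian_linear c (a : R[i]) f g :
  weighted_laplacian c (fun x => a * f x + g x) =
  fun x => a * weighted_laplacian c f x + weighted_laplacian c g x.
Proof.
apply/funext => x; rewrite /weighted_laplacian mulrCA -mulrDr; congr (_ * _).
by rewrite mulr_sumr -big_split /=; apply: eq_bigr => y _; ring.
Qed.

Lemma weighted_laplacian_eq c f g x : f x = g x -> {in nbseq x, f =1 g} ->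
  weighted_laplacian c f x = weighted_laplacian c g x.
Proof.
move=> fgx fg; rewrite /weighted_laplacian fgx; congr (_ * _).
by rewrite big_seq [RHS]big_seq; apply: eq_bigr => y /fg ->.
Qed.

(** The value at [x] is controlled by finitely many values of [f], with the
constant [M = (\sum_y |c x y|) / m x]. *)
Lemma weighted_laplacian_local c x : exists (M : R) s, 0 <= M /\
  forall f, normc (weighted_laplacian c f x) <= M * \sum_(y <- s) normc (f y).
Proof.
pose M := (m x)^-1 * \sum_(y <- nbseq x) `|c x y|.
have sum0 : 0 <= \sum_(y <- nbseq x) `|c x y| by exact: sumr_ge0.
exists M, (x :: nbseq x); split.
  by rewrite mulr_ge0// invr_ge0 ltW// m_gt0.
move=> f; rewrite /weighted_laplacian ComplexField.Normc.normcM normc_real.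
rewrite ger0_norm ?invr_ge0 ?(ltW (m_gt0 x))// -mulrA.
rewrite ler_wpM2l ?invr_ge0 ?(ltW (m_gt0 x))//.
apply: le_trans (ler_normc_sum _ _) _; rewrite mulr_suml big_seq [leRHS]big_seq.
apply: ler_sum => y yx; rewrite ComplexField.Normc.normcM normc_real ler_wpM2l//.
apply: le_trans (ler_normcD _ _) _; rewrite normc_opp big_cons lerD2l.
rewrite (big_rem y)//= lerDl; apply: sumr_ge0 => z _; exact: normc_ge0.
Qed.

(** Off [hull s], every Laplacian of a function supported in [s] vanishes; and the
sums defining the Laplacians at points of [s] run inside [hull s]. *)
Definition hull s : seq V := undup (s ++ flatten [seq nbseq x | x <- s]).

Lemma hull_uniq s : uniq (hull s). Proof. exact: undup_uniq. Qed.

Lemma sub_hull s x : x \in s -> x \in hull s.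
Proof. by move=> xs; rewrite mem_undup mem_cat xs. Qed.

Lemma hull_adjacent s x y : x \in s -> adjacent G x y -> y \in hull s.
Proof.
move=> xs xy; rewrite mem_undup mem_cat; apply/orP; right.
by apply/flattenP; exists (nbseq x); rewrite ?mem_nbseq//; apply/mapP; exists x.
Qed.

Lemma weighted_laplacian_support c f s : (forall x, x \notin s -> f x = 0) ->
  forall x, x \notin hull s -> weighted_laplacian c f x = 0.
Proof.
move=> s0 x xs; rewrite /weighted_laplacian big_seq big1 ?mulr0// => y.
rewrite mem_nbseq => xy; rewrite !s0 ?subr0 ?mulr0//.
  by apply: contra xs => ys; apply: (hull_adjacent ys); rewrite adjacentC.
by apply: contra xs; exact: sub_hull.
Qed.

Lemma weighted_laplacian_finite c f : finitely_supported f ->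
  finitely_supported (weighted_laplacian c f).
Proof.
move=> /finitely_supportedP[s us s0]; apply/finitely_supportedP.
exists (hull s); [exact: hull_uniq | exact: weighted_laplacian_support].
Qed.

Lemma weighted_laplacian_hull c f s x : adjacency_supported c ->
  x \in s ->
  (m x)%:C * weighted_laplacian c f x =
  \sum_(y <- hull s) (c x y)%:C * (f x - f y).
Proof.
move=> c0 xs; rewrite /weighted_laplacian mulrA -rmorphM divff ?gt_eqF ?m_gt0// mul1r.
apply: eq_sum_support; rewrite ?nbseq_uniq ?hull_uniq//.
  move=> y; rewrite mem_nbseq => xy; by rewrite (hull_adjacent xs xy).
by move=> y _; rewrite mem_nbseq => /c0 ->; rewrite mul0r.
Qed.

(** Outside [s] the identity still holds: there [f x = 0], and the neighbours
missing from [hull s] contribute [f x - f y = 0]. *)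
Lemma weighted_laplacian_hull_support c f s x : adjacency_supported c ->
  (forall x, x \notin s -> f x = 0) ->
  x \in hull s ->
  (m x)%:C * weighted_laplacian c f x =
  \sum_(y <- hull s) (c x y)%:C * (f x - f y).
Proof.
move=> c0 s0 xs; have [/weighted_laplacian_hull->//|xNs] := boolP (x \in s).
rewrite /weighted_laplacian mulrA -rmorphM divff ?gt_eqF ?m_gt0// mul1r.
apply: eq_sum_support; rewrite ?nbseq_uniq ?hull_uniq//.
  move=> y _ ys; rewrite !s0// ?subr0 ?mulr0//.
  by apply: contra ys; exact: sub_hull.
by move=> y _; rewrite mem_nbseq => /c0 ->; rewrite mul0r.
Qed.

(** Green's formula. Only [f] has finite support, but every nonzero term lives
on the hull of that support; there both sides are double sums, which agree after
exchanging the indices in the off-diagonal part. *)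
Lemma weighted_laplacian_symmetric c f g : adjacency_supported c ->
  (forall x y, c x y = c y x) -> finitely_supported f ->
  l2_inner m (weighted_laplacian c f) g = l2_inner m f (weighted_laplacian c g).
Proof.
move=> c0 cC /finitely_supportedP[s us s0].
have h0 x : x \notin hull s -> f x = 0.
  by move=> xs; apply: s0; apply: contra xs; exact: sub_hull.
rewrite (l2_inner_finite _ (hull_uniq s)); last first.
  by move=> x xs; left; exact: (weighted_laplacian_support _ s0).
rewrite (l2_inner_finite _ (hull_uniq s)); last first.
  by move=> x /h0; left.
have -> : inner_sum m (hull s) (weighted_laplacian c f) g =
    \sum_(x <- hull s) \sum_(y <- hull s) (c x y)%:C * (f x - f y) * conj (g x).
  rewrite /inner_sum big_seq [RHS]big_seq; apply: eq_bigr => x xs.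
  by rewrite (weighted_laplacian_hull_support c0 s0 xs) mulr_suml.
have -> : inner_sum m (hull s) f (weighted_laplacian c g) =
    \sum_(x <- hull s) \sum_(y <- hull s) (c x y)%:C * f x * (conj (g x) - conj (g y)).
  rewrite /inner_sum big_seq [RHS]big_seq; apply: eq_bigr => x xs.
  have [xs'|/s0 fx0] := boolP (x \in s); last first.
    by rewrite fx0 mulr0 mul0r big1// => y _; rewrite mulr0 mul0r.
  rewrite -mulrA.
  have -> : (m x)%:C * (f x * conj (weighted_laplacian c g x)) =
      conj ((m x)%:C * weighted_laplacian c g x) * f x.
    by rewrite conjM conjR; ring.
  rewrite (weighted_laplacian_hull _ c0 xs') conj_sum mulr_suml.
  by apply: eq_bigr => y _; rewrite conjM conjB conjR; ring.
under eq_bigr do under eq_bigr do rewrite mulrBr mulrBl.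
under [RHS]eq_bigr do under eq_bigr do rewrite mulrBr.
under eq_bigr do rewrite sumrB; under [RHS]eq_bigr do rewrite sumrB.
rewrite !sumrB; congr (_ - _).
rewrite exchange_big /=; apply: eq_bigr => x _; apply: eq_bigr => y _.
by rewrite cC.
Qed.

End GraphOperators.

(** * Accretivity *)

Section Accretive.
Local Open Scope ring_scope.
Local Open Scope complex_scope.
Variables (R : realType) (V : countType) (G : weighted_digraph R V).
Hypothesis G_lf : locally_finite G.
Hypothesis G_kirchhoff : kirchhoff G.
Local Notation b := (edge_weight G).
Local Notation m := (vertex_weight G).
Local Notation m_gt0 := (vertex_weight_gt0 G).
Implicit Types (f g h : V -> R[i]) (s : seq V).

Lemma Re_polarization (z w : R[i]) : Re ((z - w) * conj z) =
  2^-1 * (normc z ^+ 2 - normc w ^+ 2 + normc (z - w) ^+ 2).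
Proof. by rewrite !sqr_normcE; case: z w => [p q] [u v] /=; field. Qed.

Lemma Re_realM (r : R) (z : R[i]) : Re (r%:C * z) = r * Re z.
Proof. by case: z => p q /=; rewrite mul0r subr0. Qed.

(** Polarization splits the sum into the energy
[1/2 \sum b x y |f x - f y|^2 >= 0] and the difference of
[\sum b x y |f x|^2] and [\sum b x y |f y|^2]. The latter two are the sums of
[|f x|^2] times the out-weight and the in-weight of [x], equal by Kirchhoff. *)
Lemma laplacian_accretive_sum f s : uniq s -> (forall x, x \notin s -> f x = 0) ->
  0 <= Re (inner_sum m s (laplacian G f) f).
Proof.
move=> us s0.
have edge0 : adjacency_supported G b by exact: adjacency_supported_edge.
have -> : inner_sum m s (laplacian G f) f = inner_sum m (hull G s) (laplacian G f) f.
  apply: eq_sum_support; rewrite ?hull_uniq//.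
    by move=> x xs; rewrite sub_hull.
  by move=> x _ /s0 ->; rewrite rmorph0 mulr0.
rewrite laplacianE// /inner_sum Re_sum.
have -> : \sum_(x <- hull G s) Re ((m x)%:C * weighted_laplacian G b f x * conj (f x)) =
    \sum_(x <- hull G s) \sum_(y <- hull G s)
      2^-1 * (b x y * normc (f x - f y) ^+ 2) +
    2^-1 * (\sum_(x <- hull G s) \sum_(y <- hull G s) b x y * normc (f x) ^+ 2 -
     \sum_(x <- hull G s) \sum_(y <- hull G s) b x y * normc (f y) ^+ 2).
  rewrite -sumrB mulr_sumr -big_split /= big_seq [RHS]big_seq.
  apply: eq_bigr => x xs; rewrite (weighted_laplacian_hull_support G_lf edge0 s0 xs).
  rewrite mulr_suml Re_sum -sumrB mulr_sumr -big_split /=; apply: eq_bigr => y _.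
  by rewrite -mulrA Re_realM Re_polarization; ring.
have -> : \sum_(x <- hull G s) \sum_(y <- hull G s) b x y * normc (f y) ^+ 2 =
    \sum_(x <- hull G s) \sum_(y <- hull G s) b x y * normc (f x) ^+ 2.
  rewrite exchange_big /=; apply: eq_bigr => x _; rewrite -!mulr_suml.
  have [xs|/s0 ->] := boolP (x \in s); last first.
    by rewrite ComplexField.Normc.normc0 expr0n !mulr0.
  congr (_ * _); have := G_kirchhoff x.
  rewrite !(@fsbig_support_seq _ _ (hull G s)) ?hull_uniq// => y yh; apply: edge_weight0.
    by rewrite adjacentC; apply: contra yh; exact: hull_adjacent.
  by apply: contra yh; exact: hull_adjacent.
rewrite subrr mulr0 addr0; apply: sumr_ge0 => x _; apply: sumr_ge0 => y _.
by rewrite mulr_ge0 ?invr_ge0// mulr_ge0 ?edge_weight_ge0// sqr_ge0.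
Qed.

(** With [l = a + i c], the right-hand side exceeds the left-hand side by exactly
[|z + i c w|^2]. *)
Lemma sqr_normc_shift (z w l : R[i]) :
  Re l ^+ 2 * normc w ^+ 2 + 2 * Re l * Re (z * conj w) <= normc (z + l * w) ^+ 2.
Proof.
rewrite !sqr_normcE; case: z w l => [p q] [u v] [a c] /=; rewrite -subr_ge0.
set d := (X in 0 <= X).
have -> : d = (p - c * v) ^+ 2 + (q + c * u) ^+ 2 by rewrite /d; ring.
by rewrite addr_ge0 ?sqr_ge0.
Qed.

(** Both sums run over [s] only, although [laplacian G f] need not vanish off [s]:
this is the form that applies to the Dirichlet problem on [s], where the equation
is known on [s] alone. *)
Lemma sqsum_shift_ge (l : R[i]) f s : 0 < Re l -> uniq s ->
  (forall x, x \notin s -> f x = 0) ->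
  Re l ^+ 2 * sqsum m s f <= sqsum m s (fun x => laplacian G f x + l * f x).
Proof.
move=> l0 us s0; have acc := laplacian_accretive_sum us s0.
apply: (@le_trans _ _ (Re l ^+ 2 * sqsum m s f +
    2 * Re l * Re (inner_sum m s (laplacian G f) f))).
  by rewrite lerDl mulr_ge0// mulr_ge0// ltW.
rewrite /sqsum /inner_sum Re_sum !mulr_sumr -big_split /=; apply: ler_sum => x _.
rewrite -[(m x)%:C * _ * _]mulrA Re_realM !(mulrCA _ (m x)) -mulrDr.
rewrite ler_wpM2l ?(ltW (m_gt0 x))//.
exact: sqr_normc_shift.
Qed.

Lemma l2_norm_shift_ge (l : R[i]) f : 0 < Re l -> finitely_supported f ->
  Re l * l2_norm m f <= l2_norm m (fun x => laplacian G f x + l * f x).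
Proof.
move=> l0 ff; have /finitely_supportedP[s us s0] := ff.
have [lf nf] := l2_norm_finite m_gt0 us s0.
have lD : l2 m (laplacian G f).
  rewrite laplacianE//; apply: finitely_supported_l2; first exact: m_gt0.
  exact: weighted_laplacian_finite.
have [ls _] := l2_normD m_gt0 lD (l2_normZ m_gt0 l lf).1.
rewrite -(@ler_pXn2r _ 2) ?nnegrE ?l2_normr_ge0 ?mulr_ge0 ?(ltW l0) ?l2_normr_ge0//.
rewrite exprMn nf; apply: le_trans (sqsum_shift_ge l0 us s0) _.
exact: (sqsum_le_norm m_gt0 ls us).
Qed.

(** The equation is a linear system with as many unknowns as equations, and a
solution of the homogeneous one vanishes by [sqsum_shift_ge]. *)
Lemma dirichlet_problem (l : R[i]) h s : 0 < Re l -> uniq s ->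
  exists2 f, forall x, x \notin s -> f x = 0 &
    forall x, x \in s -> laplacian G f x + l * f x = h x.
Proof.
move=> l0 us.
pose T := in_tuple s; pose n := size s.
pose phi (i : 'I_n) : V -> R[i] := fun x => (x == tnth T i)%:R.
pose L f x := laplacian G f x + l * f x.
pose F (v : 'rV[R[i]]_n) : V -> R[i] := fun x => \sum_i v 0 i * phi i x.
pose M := \matrix_(i < n, j < n) L (phi i) (tnth T j).
have F0 v x : x \notin s -> F v x = 0.
  move=> xs; rewrite /F big1// => i _; rewrite /phi (negbTE (_ : x != tnth T i)) ?mulr0//.
  by apply: contra xs => /eqP ->; exact: mem_tnth.
have FT v j : F v (tnth T j) = v 0 j.
  rewrite /F (bigD1 j)//= big1 ?addr0 /phi ?eqxx ?mulr1// => i ij.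
  by rewrite (inj_eq (elimT (tuple_uniqP T) us)) eq_sym (negbTE ij) mulr0.
have LF v j : L (F v) (tnth T j) = (v *m M) 0 j.
  rewrite mxE /L laplacianE// /weighted_laplacian.
  transitivity (\sum_i (v 0 i * (((m (tnth T j))^-1)%:C *
       \sum_(y <- nbseq G (tnth T j)) (b (tnth T j) y)%:C * (phi i (tnth T j) - phi i y))
       + v 0 i * (l * phi i (tnth T j)))); last first.
    by apply: eq_bigr => i _; rewrite -mulrDr mxE /L laplacianE.
  rewrite big_split /=; congr (_ + _); last first.
    by rewrite /F mulr_sumr; apply: eq_bigr => i _; rewrite mulrCA.
  under [RHS]eq_bigr do rewrite mulrCA mulr_sumr.
  rewrite -mulr_sumr exchange_big /=; congr (_ * _); apply: eq_bigr => y _.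
  rewrite /F -sumrB mulr_sumr; apply: eq_bigr => i _; ring.
have Munit : M \in unitmx.
  rewrite unitmxE unitfE; apply/det0P => -[v v0 vM]; move/negP: v0; apply.
  apply/eqP/rowP => j; rewrite mxE.
  have LF0 x : x \in s -> L (F v) x = 0.
    by move=> /(tnthP T)[k ->]; rewrite LF vM mxE.
  have : Re l ^+ 2 * sqsum m s (F v) <= 0.
    apply: le_trans (sqsum_shift_ge l0 us (F0 v)) _.
    rewrite /sqsum big_seq big1// => x /LF0; rewrite /L => ->.
    by rewrite ComplexField.Normc.normc0 expr0n mulr0.
  rewrite pmulr_rle0 ?exprn_gt0// => le0.
  have : sqsum m s (F v) == 0 by rewrite eq_le le0 (sqsum_ge0 m_gt0).
  rewrite psumr_eq0 => [/allP/(_ (tnth T j) (mem_tnth _ _))|x _]; last first.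
    exact: (sqsum_term_ge0 m_gt0).
  by rewrite /= mulf_eq0 gt_eqF ?m_gt0//= expf_eq0 /= normc_eq0P FT => /eqP.
pose v := (\row_j h (tnth T j)) *m invmx M.
exists (F v); first exact: F0.
by move=> x /(tnthP T)[k ->]; rewrite -/(L (F v) _) LF /v mulmxKV// mxE.
Qed.

End Accretive.

(** * Pointwise compactness *)

Section PointwiseClusterPoint.
Local Open Scope ring_scope.
Local Open Scope complex_scope.
Variables (R : realType) (V : countType).

(** Tychonoff for the product of the intervals [[- C x, C x]], one for the real and
one for the imaginary part at each [x]. A cluster point is enough, since each
use below involves finitely many points at a time. *)
Lemma pointwise_cluster_point (u : nat -> V -> R[i]) (C : V -> R) :
  (forall n x, normc (u n x) <= C x) ->
  exists f, forall (s : seq V) (e : R) (N : nat), 0 < e ->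
    exists2 n, (N <= n)%N & forall x, x \in s -> normc (u n x - f x) < e.
Proof.
move=> uC.
pose I : eqType := (V * bool)%type; pose T (i : I) : topologicalType := R.
pose A (i : I) : set (T i) := `[- C i.1, C i.1]%classic.
pose w n : forall i, T i := fun i => if i.2 then Re (u n i.1) else Im (u n i.1).
have K := @tychonoff I T A (fun i => @segment_compact R (- C i.1) (C i.1)).
have [|p [_ clp]] := K (w @ \oo) _.
  exists 0%N => // n _ [x []] /=; rewrite /A /= in_itv /= -ler_norml;
    apply: le_trans (uC n x).
    by have [] := ler_ReIm (u n x).
  by have [] := ler_ReIm (u n x).
exists (fun x => (p (x, true) : R) +i* (p (x, false) : R)) => s e N e0.
have e20 : 0 < e / 2 by rewrite divr_gt0.
pose close : set (forall i, T i) := [set g | forall x, x \in s ->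
   `|(p (x, true) : R) - g (x, true)| < e / 2 /\
   `|(p (x, false) : R) - g (x, false)| < e / 2].
have nbi i : nbhs (p : prod_topology T) [set g : forall i, T i | `|(p i : R) - g i| < e / 2].
  have := @proj_continuous I T i p [set r : R | `|(p i : R) - r| < e / 2].
  by apply; apply/nbhs_ballP; exists (e / 2).
have nbc : nbhs (p : prod_topology T) close.
  rewrite /close; elim: s {close} => [|x s IH].
    by apply: filterS filterT => g _ x.
  apply: filterS (filterI IH (filterI (nbi (x, true)) (nbi (x, false)))).
  move=> g [gs [g1 g2]] y; rewrite inE => /orP[/eqP ->|/gs//]; by split.
have FN : (w @ \oo) [set w n | n in [set n | (N <= n)%N]].
  by exists N => // n /= Nn; exists n.
have [_ [[n Nn <-] cl]] := clp _ _ FN nbc.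
exists n => // x /cl [c1 c2]; apply: le_lt_trans (normc_ReIm _) _.
rewrite [ltRHS]splitr; move: c1 c2; rewrite /w /=.
rewrite !(distrC (p _)); case: (u n x) => a c /=; exact: ltrD.
Qed.

End PointwiseClusterPoint.

(** * The resolvent equation and the closure of the Laplacian *)

Section MAccretive.
Local Open Scope ring_scope.
Local Open Scope complex_scope.
Variables (R : realType) (V : countType) (G : weighted_digraph R V).
Hypothesis G_lf : locally_finite G.
Hypothesis G_kirchhoff : kirchhoff G.
Local Notation b := (edge_weight G).
Local Notation m := (vertex_weight G).
Local Notation m_gt0 := (vertex_weight_gt0 G).
Local Notation Cc := (@finitely_supported R V).
Implicit Types (f g h : V -> R[i]) (s : seq V).

Definition exhaustion n : seq V := undup (pmap (@choice.unpickle V) (iota 0 n)).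

Lemma mem_exhaustion n x : (choice.pickle x < n)%N -> x \in exhaustion n.
Proof.
move=> xn; rewrite mem_undup mem_pmap; apply/mapP; exists (choice.pickle x).
  by rewrite mem_iota.
by rewrite choice.pickleK.
Qed.

(** A weak form of Fatou's lemma: on a finite set [s] the cluster point [f] is
within distance [1] of some [u n], so its sums are bounded by [(C + 2)^2]. *)
Lemma pointwise_limit_l2 (u : nat -> V -> R[i]) f (C : R) :
  (forall n, l2 m (u n) /\ l2_norm m (u n) <= C) ->
  (forall (s : seq V) (e : R) (N : nat), 0 < e ->
    exists2 n, (N <= n)%N & forall x, x \in s -> normc (u n x - f x) < e) ->
  l2 m f.
Proof.
move=> uC uf; have C0 : 0 <= C := le_trans (l2_normr_ge0 _ _) (uC 0%N).2.
have C1 : 0 < C + 1 by rewrite ltr_wpDl.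
have [] // := @l2_bounded _ _ _ m_gt0 f ((C + 1) + 1); first by rewrite addr_ge0// ltW.
move=> s us; pose S := \sum_(x <- s) m x.
have S0 : 0 <= S by apply: sumr_ge0 => x _; exact/ltW/m_gt0.
have S1 : 0 < S + 1 by rewrite ltr_wpDl.
(* [e ^+ 2 * S <= 1], with [S + 1] in place of [S] in case [s] is empty *)
pose e := (Num.sqrt (S + 1))^-1.
have e0 : 0 < e by rewrite invr_gt0 sqrtr_gt0.
have [n _ un] := uf s e 0%N e0.
have -> : f = fun x => u n x + (f x - u n x) by apply/funext => x; ring.
apply: (sqsum_Minkowski m_gt0) => //.
  apply: (sqsum_le_sqr m_gt0) => //; first exact: (uC n).1.
  by apply: le_trans (uC n).2 _; rewrite lerDl.
apply: (@le_trans _ _ (\sum_(x <- s) m x * e ^+ 2)).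
  rewrite /sqsum big_seq [leRHS]big_seq; apply: ler_sum => x xs.
  rewrite ler_wpM2l ?(ltW (m_gt0 x))// ler_pXn2r ?nnegrE ?normc_ge0 ?(ltW e0)//.
  by rewrite -normc_opp opprB ltW// un.
rewrite -mulr_suml /e exprVn sqr_sqrtr ?(ltW S1)// ler_pdivrMr// expr1n mul1r.
by rewrite lerDl.
Qed.

(** The solutions on the finite sets [exhaustion n] are bounded in norm by
[|h| / Re l]. At each [x] the equation only involves finitely many values, so
it holds up to an arbitrarily small error for a pointwise cluster point. *)
Lemma resolvent_equation (l : R[i]) h : 0 < Re l -> l2 m h ->
  exists2 f, l2 m f & forall x, laplacian G f x + l * f x = h x.
Proof.
move=> l0 lh.
have us n : uniq (exhaustion n) by exact: undup_uniq.
have /choice [u uP] : forall n, exists f, (forall x, x \notin exhaustion n -> f x = 0) /\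
    (forall x, x \in exhaustion n -> laplacian G f x + l * f x = h x).
  move=> n; have [f f0 fh] := dirichlet_problem G_lf G_kirchhoff h l0 (us n).
  by exists f.
pose C := l2_norm m h / Re l.
have uC n : l2 m (u n) /\ l2_norm m (u n) <= C.
  have [u0 uh] := uP n; have [lu nu] := l2_norm_finite m_gt0 (us n) u0.
  split=> //; have C0 : 0 <= C by rewrite divr_ge0 ?l2_normr_ge0// ltW.
  rewrite -(@ler_pXn2r _ 2) ?nnegrE ?l2_normr_ge0// nu /C expr_div_n.
  rewrite ler_pdivlMr ?exprn_gt0// mulrC.
  apply: le_trans (sqsum_shift_ge G_lf G_kirchhoff l0 (us n) u0) _.
  apply: le_trans (sqsum_le_norm m_gt0 lh (us n)).
  by rewrite /sqsum big_seq [leRHS]big_seq; apply: ler_sum => x /uh ->.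
have u_bounded n x : normc (u n x) <= C / Num.sqrt (m x).
  apply: le_trans (le_normc_l2 m_gt0 x (uC n).1) _.
  by rewrite ler_wpM2r ?invr_ge0 ?sqrtr_ge0//; exact: (uC n).2.
have [f fP] := pointwise_cluster_point u_bounded.
exists f; first exact: pointwise_limit_l2 uC fP.
move=> x; apply/eqP; rewrite -subr_eq0 -normc_eq0P eq_le normc_ge0 andbT.
have [M [s [M0 Ms]]] := weighted_laplacian_local G b x.
apply: (@le0_vanishing_bound _ _ (M * \sum_(y <- s) 1 + normc l)).
  by rewrite addr_ge0 ?normc_ge0// mulr_ge0// sumr_ge0.
(* [n] exceeds the index of [x], so that [u n] solves the equation at [x] *)
move=> e e0; have [n xn un] := fP (x :: s) e (choice.pickle x).+1 e0.
have <- := (uP n).2 x (mem_exhaustion xn).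
have -> : laplacian G f x + l * f x - (laplacian G (u n) x + l * u n x) =
   laplacian G (fun y => -1 * u n y + f y) x + l * (f x - u n x).
  by rewrite !laplacianE// weighted_laplacian_linear; ring.
have close y : y \in x :: s -> normc (f y - u n y) <= e.
  by move=> /un /ltW; rewrite -normc_opp opprB.
apply: le_trans (ler_normcD _ _) _; rewrite [leRHS]mulrDr; apply: lerD.
  rewrite laplacianE//; apply: le_trans (Ms _) _.
  rewrite mulrCA ler_wpM2l// mulr_sumr big_seq [leRHS]big_seq.
  apply: ler_sum => y ys; rewrite mulr1; rewrite mulN1r addrC close// inE ys orbT//.
by rewrite ComplexField.Normc.normcM mulrC ler_wpM2r ?normc_ge0// close// mem_head.
Qed.

(** On a finite set [s] the function may be replaced by its truncation to [hull s],
which has the same image on [s] and a smaller norm. *)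
Lemma bounded_weighted_laplacian_l2 c (K : R) : 0 <= K ->
  (forall f, finitely_supported f ->
     l2_norm m (weighted_laplacian G c f) <= K * l2_norm m f) ->
  forall f, l2 m f -> l2 m (weighted_laplacian G c f) /\
    l2_norm m (weighted_laplacian G c f) <= K * l2_norm m f.
Proof.
move=> K0 cK f lf; apply: (l2_bounded m_gt0); first by rewrite mulr_ge0// l2_normr_ge0.
move=> s us; pose g x := if x \in hull G s then f x else 0.
have g0 x : x \notin hull G s -> g x = 0 by rewrite /g => /negbTE ->.
have ug := @hull_uniq _ _ G s.
have fg : finitely_supported g by apply/finitely_supportedP; exists (hull G s).
have -> : sqsum m s (weighted_laplacian G c f) = sqsum m s (weighted_laplacian G c g).
  rewrite /sqsum big_seq [RHS]big_seq; apply: eq_bigr => x xs; congr (_ * normc _ ^+ 2).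
  apply: weighted_laplacian_eq; first by rewrite /g sub_hull.
  by move=> y; rewrite mem_nbseq// => xy; rewrite /g (hull_adjacent G_lf xs xy).
have lg : l2 m (weighted_laplacian G c g).
  by apply: (finitely_supported_l2 m_gt0); exact: weighted_laplacian_finite.
apply: (sqsum_le_sqr m_gt0) => //; apply: le_trans (cK g fg) _.
rewrite ler_wpM2l// -(@ler_pXn2r _ 2) ?nnegrE ?l2_normr_ge0//.
rewrite (l2_norm_finite m_gt0 ug g0).2.
apply: le_trans (sqsum_le_norm m_gt0 lf ug).
by rewrite /sqsum big_seq [leRHS]big_seq; apply: ler_sum => x xs; rewrite /g xs.
Qed.

Local Notation Delta := (graph_on Cc (laplacian G)).
Local Notation H := (graph_on Cc (laplacian_sym G)).

Lemma graph_laplacianE : Delta = graph_on Cc (weighted_laplacian G b).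
Proof. by congr (graph_on _ _); apply/funext => f; rewrite laplacianE. Qed.

Lemma closure_laplacian_operator : is_operator m (op_closure m Delta).
Proof.
rewrite graph_laplacianE; apply: op_closure_is_operator; first exact: m_gt0.
- exact: weighted_laplacian_linear.
- exact: weighted_laplacian_local.
- by move=> f; exact: weighted_laplacian_finite.
Qed.

(** The inner product is continuous along the approximation in the graph norm,
and nonnegative real part is known for finitely supported functions. *)
Lemma closure_laplacian_accretive p : op_closure m Delta p ->
  0 <= Re (l2_inner m p.2 p.1).
Proof.
move=> [l1 l2' app]; rewrite -oppr_le0.
pose N1 := l2_norm m p.1; pose N2 := l2_norm m p.2.
have N10 : 0 <= N1 by exact: l2_normr_ge0.
have N20 : 0 <= N2 by exact: l2_normr_ge0.
apply: (@le0_vanishing_bound _ _ ((N1 + 1) + (N2 + 2))); first by rewrite !addr_ge0.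
(* capping [e] at 1 bounds the norm of [q.2] independently of [e] *)
move=> e0 e00; pose e := Num.min e0 1.
have e_gt0 : 0 < e by rewrite lt_min e00 ltr01.
have [ee0 e1] : e <= e0 /\ e <= 1 by split; rewrite ge_min lexx ?orbT.
have [q [fq q2] [n1 n2]] := app e e_gt0.
have lq1 := finitely_supported_l2 m_gt0 fq.
have lq2 : l2 m q.2.
  rewrite q2 laplacianE//; apply: (finitely_supported_l2 m_gt0).
  exact: weighted_laplacian_finite.
have acc : 0 <= Re (l2_inner m q.2 q.1).
  have /finitely_supportedP[s us s0] := fq.
  rewrite (l2_inner_finite _ us) => [|x /s0]; last by right.
  by rewrite q2; exact: laplacian_accretive_sum.
have nq2 : l2_norm m q.2 <= N2 + 2.
  have -> : q.2 = fun x => p.2 x + (-1 * (p.2 \- q.2) x) by apply/funext => x /=; ring.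
  have lb := (l2_normB m_gt0 l2' lq2).1; have [lN nN] := l2_normZ m_gt0 (-1) lb.
  apply: le_trans (l2_normD m_gt0 l2' lN).2 _; rewrite lerD2l.
  apply: le_trans nN _; rewrite normc_opp ComplexField.Normc.normc1 mul1r.
  by apply: le_trans (ltW n2) _; lra.
have cl : normc (l2_inner m p.2 p.1 - l2_inner m q.2 q.1) <= e * (N1 + 1) + (N2 + 2) * e.
  by apply: (l2_inner_close m_gt0) => //; rewrite ?ltr_wpDl ?lerDl//; exact: ltW.
have [+ _] := ler_ReIm (l2_inner m p.2 p.1 - l2_inner m q.2 q.1).
rewrite ReD => /le_trans /(_ cl); rewrite ler_norml => /andP[+ _].
have -> : Re (- l2_inner m q.2 q.1) = - Re (l2_inner m q.2 q.1).
  by case: (l2_inner m q.2 q.1).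
nra.
Qed.

Lemma closure_laplacian_bound (l : R[i]) p : 0 < Re l -> op_closure m Delta p ->
  Re l * l2_norm m p.1 <= l2_norm m (fun x => p.2 x + l * p.1 x).
Proof.
move=> l0; rewrite graph_laplacianE.
apply: op_closure_bound; first exact: m_gt0.
- by move=> f; exact: weighted_laplacian_finite.
- exact: ltW.
- by move=> f ff; rewrite -laplacianE//; exact: l2_norm_shift_ge.
Qed.

(** Green's formula pairs [f] with finitely supported functions; continuity of the
inner product extends it to the closure. *)
Lemma sym_maximal_adjoint f : l2 m f -> l2 m (laplacian_sym G f) ->
  op_adjoint m (op_closure m H) (f, laplacian_sym G f).
Proof.
move=> lf lHf; split=> //= q [lq1 lq2 app]; apply/eqP.
rewrite -subr_eq0 -normc_eq0P eq_le normc_ge0 andbT.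
have nonneg h : 0 <= l2_norm m h by exact: l2_normr_ge0.
have pos h : 0 < l2_norm m h + 1 by rewrite ltr_wpDl// nonneg.
apply: (@le0_vanishing_bound _ _
  ((l2_norm m f + 1) + 1 + ((l2_norm m (laplacian_sym G f) + 1) + 1))).
  by rewrite !addr_ge0.
move=> e e0; have [r [fr r2] [n1 n2]] := app e e0.
have lr1 := finitely_supported_l2 m_gt0 fr.
have lr2 : l2 m r.2.
  rewrite r2 laplacian_symE//; apply: (finitely_supported_l2 m_gt0).
  exact: weighted_laplacian_finite.
have green : l2_inner m r.2 f = l2_inner m r.1 (laplacian_sym G f).
  rewrite r2 !laplacian_symE//; apply: weighted_laplacian_symmetric => //.
    move=> x y xy; rewrite /sym_weight !edge_weight0 ?addr0 ?mulr0//.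
    by rewrite adjacentC.
  by move=> x y; rewrite /sym_weight addrC.
have close g h k : l2 m g -> l2 m h -> l2 m k -> l2_norm m (g \- h) < e ->
    normc (l2_inner m g k - l2_inner m h k) <= e * ((l2_norm m k + 1) + 1).
  move=> lg lh lk gh.
  have kk : l2_norm m (k \- k) = 0.
    rewrite -(l2_0 m_gt0).2; congr l2_norm; apply/funext => x; exact: subrr.
  (* the second slot does not move, so any positive distance bound serves *)
  have -> : e * ((l2_norm m k + 1) + 1) =
      e * (l2_norm m k + 1) + (l2_norm m h + 1) * (e / (l2_norm m h + 1)).
    by rewrite mulrCA divff ?gt_eqF// mulr1 mulrDr mulr1.
  apply: (l2_inner_close m_gt0) => //; rewrite ?lerDl ?divr_gt0//; first exact: ltW.
  by rewrite kk divr_ge0// ltW.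
have -> : l2_inner m q.2 f - l2_inner m q.1 (laplacian_sym G f) =
   (l2_inner m q.2 f - l2_inner m r.2 f) -
   (l2_inner m q.1 (laplacian_sym G f) - l2_inner m r.1 (laplacian_sym G f)).
  by rewrite green; ring.
apply: le_trans (ler_normcD _ _) _; rewrite normc_opp mulrDr.
by apply: lerD; exact: close.
Qed.

(** [f] belongs to the domain of the closure of [H] by self-adjointness, and adding
the bounded operator [B] does not change the graph topology. *)
Lemma closure_laplacian_maximal f :
  essentially_self_adjoint m H ->
  bounded_op m (graph_on Cc (laplacian_skew G)) ->
  l2 m f -> l2 m (laplacian G f) -> op_closure m Delta (f, laplacian G f).
Proof.
move=> [_ _ Hsa] [K0 BK0] lf lDf; pose K := `|K0|.
have BK g : l2 m g -> l2 m (laplacian_skew G g) /\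
    l2_norm m (laplacian_skew G g) <= K * l2_norm m g.
  rewrite laplacian_skewE//; apply: bounded_weighted_laplacian_l2; first exact: normr_ge0.
  move=> h fh; have Bh : graph_on Cc (laplacian_skew G) (h, laplacian_skew G h) by split.
  have := BK0 _ Bh.
  rewrite /= laplacian_skewE// => /le_trans; apply.
  by rewrite ler_wpM2r ?l2_normr_ge0// ler_norm.
have lHf : l2 m (laplacian_sym G f).
  have -> : laplacian_sym G f = laplacian G f \- laplacian_skew G f.
    by apply/funext => x; rewrite laplacian_sym_skew /= addrK.
  exact: (l2_normB m_gt0 lDf (BK _ lf).1).1.
have := sym_maximal_adjoint lf lHf; rewrite Hsa => -[_ _ /= app].
(* the two errors below are less than [d] and at most [K * d] *)
split=> //= e e0; pose d := e / (K + 2).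
have K2 : 0 < K + 2 by rewrite ltr_wpDl// normr_ge0.
have d0 : 0 < d by rewrite divr_gt0.
have [q [fq q2] [n1 n2]] := app d d0; exists (q.1, laplacian G q.1); first by split.
have lq1 := finitely_supported_l2 m_gt0 fq.
have lq2 : l2 m q.2.
  rewrite q2 laplacian_symE//; apply: (finitely_supported_l2 m_gt0).
  exact: weighted_laplacian_finite.
have K_ge0 : 0 <= K by exact: normr_ge0.
have de : (K + 2) * d = e by rewrite /d mulrC divfK// gt_eqF.
split=> /=; first by apply: lt_trans n1 _; nra.
have lb1 := (l2_normB m_gt0 lf lq1).1.
have -> : laplacian G f \- laplacian G q.1 =
   fun x => (laplacian_sym G f \- q.2) x + laplacian_skew G (f \- q.1) x.
  apply/funext => x; rewrite !laplacian_sym_skew /= q2.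
  have -> : f \- q.1 = fun y => -1 * q.1 y + f y by apply/funext => y /=; ring.
  rewrite ![laplacian_skew _ _]laplacian_skewE// weighted_laplacian_linear; ring.
have [lB nB] := BK _ lb1.
apply: le_lt_trans (l2_normD m_gt0 (l2_normB m_gt0 lHf lq2).1 lB).2 _.
nra.
Qed.

Lemma closure_laplacian_m_accretive :
  essentially_self_adjoint m H ->
  bounded_op m (graph_on Cc (laplacian_skew G)) ->
  m_accretive m (op_closure m Delta).
Proof.
move=> Hesa Bbd; have opD := closure_laplacian_operator.
have [Dl2 D0 Dlin Dsv] := opD.
split.
- by split=> // p; exact: closure_laplacian_accretive.
- move=> z z0; rewrite /resolvent_set /=; set T := op_inverse _.
  have l0 : 0 < Re (- z) by case: z z0 {T} => a c /=; rewrite oppr_gt0.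
  have bound p : T p -> Re (- z) * l2_norm m p.2 <= l2_norm m p.1.
    by move=> [_ [p' Dp' <-] <-] /=; exact: closure_laplacian_bound.
  split; first split.
  + move=> _ [_ [p Dp <-] <-] /=; have [lp1 lp2] := Dl2 p Dp; split=> //.
    by apply: (l2_normD m_gt0 lp2 _).1; exact: (l2_normZ m_gt0 _ lp1).1.
  + exists (fun=> 0, fun=> 0) => //; exists (fun=> 0, fun=> 0) => //=.
    by congr pair; apply/funext => x; rewrite mulr0 addr0.
  + move=> a _ _ [_ [p Dp <-] <-] [_ [q Dq <-] <-] /=.
    eexists; first by eexists; first exact: (Dlin a p q Dp Dq).
    by congr pair; apply/funext => x /=; ring.
  + move=> h _ _ [_ [p Dp <-] [<- <-]] [_ [q Dq <-] [Eh <-]].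
    have Dd := Dlin (-1) p q Dp Dq.
    have := @closure_laplacian_bound _ _ l0 Dd => /=.
    have -> : (fun x => -1 * p.2 x + q.2 x + - z * (-1 * p.1 x + q.1 x)) = fun=> 0.
      apply/funext => x; have /= Ex := congr1 (@^~ x) Eh.
      transitivity ((q.2 x + - z * q.1 x) - (p.2 x + - z * p.1 x)); first by ring.
      by rewrite Ex subrr.
    rewrite (l2_0 m_gt0).2 pmulr_rle0// => le0.
    apply/funext => x; apply/eqP; rewrite eq_sym -subr_eq0 -normc_eq0P.
    rewrite eq_le normc_ge0 andbT.
    have -> : q.1 x - p.1 x = -1 * p.1 x + q.1 x by ring.
    apply: le_trans (le_normc_l2 m_gt0 x (Dl2 _ Dd).1) _ => /=.
    by rewrite pmulr_lle0 ?invr_gt0 ?sqrtr_gt0 ?m_gt0.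
  + move=> h lh; have [f lf fh] := resolvent_equation l0 lh.
    have lD : l2 m (laplacian G f).
      have -> : laplacian G f = fun x => h x + (z * f x).
        by apply/funext => x; rewrite -fh; ring.
      exact: (l2_normD m_gt0 lh (l2_normZ m_gt0 z lf).1).1.
    exists f; eexists.
      by eexists; first exact: closure_laplacian_maximal Hesa Bbd lf lD.
    by congr pair; apply/funext => x /=; exact: fh.
  + exists (Re (- z))^-1 => p /bound; rewrite mulrC => ?.
    by rewrite ler_pdivlMl// mulrC.
- move=> l l0; apply: ge_ereal_sup => _ [_ [[_ [p Dp <-] <-] n1] <-] /=.
  rewrite lee_fin -[leRHS]mulr1 ler_pdivlMl//.
  by apply: le_trans n1; exact: closure_laplacian_bound.
Qed.

End MAccretive.

Theorem theorem3p1p1 (R : realType) (V : countType) (G : weighted_digraph R V)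
    (V_infinite : infinite_set [set: V])
    (G_locally_finite : locally_finite G)
    (G_weakly_connected : weakly_connected G)
    (G_positive_outdegree : positive_outdegree G)
    (G_kirchhoff : kirchhoff G)
    (H_esa : essentially_self_adjoint (vertex_weight G)
       (graph_on (@finitely_supported R V) (laplacian_sym G)))
    (B_bounded : bounded_op (vertex_weight G)
       (graph_on (@finitely_supported R V) (laplacian_skew G))) :
  m_accretive (vertex_weight G)
    (op_closure (vertex_weight G)
       (graph_on (@finitely_supported R V) (laplacian G))).
Proof. exact: closure_laplacian_m_accretive. Qed.
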